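(* Let $M$ be a countable set-homogeneous structure. Then $M$ is uniformly homogeneous if and only if for every finitely generated substructure $A$ of $M$ there exists a group homomorphism $E_A\colon \operatorname{Aut}(A)\to\operatorname{Aut}(M)$ such that $E_A(h)$ is an extension of $h$ for every $h\in\operatorname{Aut}(A)$.
   Context: A structure is a model of a fixed countable first-order language, possibly involving algebraic operations (function symbols and constants) as well as relations. A substructure of $M$ is a subset closed under all operations of $M$ (in particular containing all constants), with the induced relations. $\operatorname{Aut}(M)$ denotes the automorphism group of $M$. A structure $M$ is set-homogeneous if for every two isomorphic finitely generated substructures $A$ and $B$ of $M$ there is an automorphism $f$ of $M$ such that $f[A]=B$. A structure $M$ is uniformly homogeneous if there is a functor $K$ from the category of all isomorphisms between finitely generated substructures of $M$ into the group $\operatorname{Aut}(M)$ (viewed as a category with a single object) such that $K(f)$ is an extension of $f$ for each $f$. Equivalently, $K$ assigns to each isomorphism $f$ between finitely generated substructures of $M$ a map $K(f)$ so that: (1) $K(\mathrm{id}_A)=\mathrm{id}_M$; (2) $K(f)\in\operatorname{Aut}(M)$ and $K(f)$ extends $f$; (3) $K(f\circ g)=K(f)\circ K(g)$, for all isomorphisms $f\colon A\to B$, $g\colon C\to A$ with $A,B,C$ finitely generated substructures of $M$. *)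

(* Defs.v *)
From HB Require Import structures.
From mathcomp Require Import all_boot.
From mathcomp Require Import boolp classical_sets functions cardinality.
Set Implicit Arguments.
Unset Strict Implicit.
Unset Printing Implicit Defensive.

Local Open Scope classical_set_scope.

(* Constants are the function symbols of arity 0. *)
Record language := Language {
  funsym : Type;
  fun_arity : funsym -> nat;
  relsym : Type;
  rel_arity : relsym -> nat }.

Definition countable_language (L : language) : Prop :=
  countable [set: funsym L] /\ countable [set: relsym L].

Record structure (L : language) := Structure {
  domain :> Type;
  fun_interp : forall s : funsym L, ('I_(fun_arity s) -> domain) -> domain;
  rel_interp : forall r : relsym L, ('I_(rel_arity r) -> domain) -> Prop }.

Arguments fun_interp {L M} s x : rename.
Arguments rel_interp {L M} r x : rename.

(* The inverse is stored as data; since it is determined by [iso_fun], two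
   isomorphisms with the same underlying function are equal ([iso_eq]). *)
Record iso (L : language) (M N : structure L) := Iso {
  iso_fun :> M -> N;
  iso_inv : N -> M;
  iso_funK : cancel iso_fun iso_inv;
  iso_invK : cancel iso_inv iso_fun;
  iso_op : forall (s : funsym L) (x : 'I_(fun_arity s) -> M),
    iso_fun (fun_interp s x) = fun_interp s (iso_fun \o x);
  iso_rel : forall (r : relsym L) (x : 'I_(rel_arity r) -> M),
    rel_interp r x <-> rel_interp r (iso_fun \o x) }.

Definition isomorphic (L : language) (M N : structure L) : Prop :=
  inhabited (iso M N).

Lemma iso_eq (L : language) (M N : structure L) (f g : iso M N) :
  iso_fun f =1 iso_fun g -> f = g.
Proof.
case: f g => [f f' fK f'K fo fr] [g g' gK g'K go gr] /= /funext fg.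
subst g; have e : f' = g' by apply/funext => y; rewrite -{1}(g'K y) fK.
by subst g'; congr Iso; exact: Prop_irrelevance.
Qed.

Section IsoGroupoid.
Variable L : language.
Implicit Type M : structure L.

Definition iso_id M : iso M M :=
  {| iso_fun := id; iso_inv := id;
     iso_funK _ := erefl; iso_invK _ := erefl;
     iso_op _ _ := erefl; iso_rel _ _ := iff_refl _ |}.

Section Comp.
Variables (M N P : structure L) (f : iso N P) (g : iso M N).

Fact iso_comp_op (s : funsym L) (x : 'I_(fun_arity s) -> M) :
  (f \o g) (fun_interp s x) = fun_interp s ((f \o g) \o x).
Proof. by rewrite /= !iso_op. Qed.
Fact iso_comp_rel (r : relsym L) (x : 'I_(rel_arity r) -> M) :
  rel_interp r x <-> rel_interp r ((f \o g) \o x).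
Proof. by rewrite (iso_rel g) (iso_rel f). Qed.

Definition iso_comp : iso M P :=
  {| iso_fun := f \o g; iso_inv := iso_inv g \o iso_inv f;
     iso_funK := can_comp (iso_funK f) (iso_funK g);
     iso_invK := can_comp (iso_invK g) (iso_invK f);
     iso_op := iso_comp_op; iso_rel := iso_comp_rel |}.

End Comp.

Section Sym.
Variables (M N : structure L) (f : iso M N).

Fact iso_sym_op (s : funsym L) (x : 'I_(fun_arity s) -> N) :
  iso_inv f (fun_interp s x) = fun_interp s (iso_inv f \o x).
Proof.
apply: (can_inj (iso_funK f)); rewrite iso_invK iso_op; congr fun_interp.
by apply/funext => i /=; rewrite iso_invK.
Qed.
Fact iso_sym_rel (r : relsym L) (x : 'I_(rel_arity r) -> N) :
  rel_interp r x <-> rel_interp r (iso_inv f \o x).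
Proof.
rewrite (iso_rel f); suff -> : f \o (iso_inv f \o x) = x by [].
by apply/funext => i /=; rewrite iso_invK.
Qed.

Definition iso_sym : iso N M :=
  {| iso_fun := iso_inv f; iso_inv := f;
     iso_funK := iso_invK f; iso_invK := iso_funK f;
     iso_op := iso_sym_op; iso_rel := iso_sym_rel |}.

End Sym.

End IsoGroupoid.

Definition aut (L : language) (M : structure L) : Type := iso M M.

(* [Aut(M)] as a group: the product [f * g] is the composite "f after g". *)
Section AutGroup.
Variables (L : language) (M : structure L).

HB.instance Definition _ := gen_eqMixin (aut M).
HB.instance Definition _ := gen_choiceMixin (aut M).

Let aut_one : aut M := iso_id M.
Let aut_mul (f g : aut M) : aut M := iso_comp f g.
Let aut_inv (f : aut M) : aut M := iso_sym f.

Fact aut_mulA : associative aut_mul.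
Proof. by move=> f g h; apply: iso_eq. Qed.
Fact aut_1mul : left_id aut_one aut_mul.
Proof. by move=> f; apply: iso_eq. Qed.
Fact aut_mul1 : right_id aut_one aut_mul.
Proof. by move=> f; apply: iso_eq. Qed.
Fact aut_Vmul : left_inverse aut_one aut_inv aut_mul.
Proof. by move=> f; apply: iso_eq => x; exact: (iso_funK f). Qed.
Fact aut_mulV : right_inverse aut_one aut_inv aut_mul.
Proof. by move=> f; apply: iso_eq => x; exact: (iso_invK f). Qed.

HB.instance Definition _ :=
  isGroup.Build (aut M) aut_mulA aut_1mul aut_mul1 aut_Vmul aut_mulV.

End AutGroup.

Definition op_closed (L : language) (M : structure L) (A : set M) : Prop :=
  forall (s : funsym L) (x : 'I_(fun_arity s) -> M),
    (forall i, A (x i)) -> A (fun_interp s x).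

Definition finitely_generated (L : language) (M : structure L) (A : set M) :
    Prop :=
  exists2 X : set M, finite_set X & A = smallest (@op_closed L M) X.

Record fg_substructure (L : language) (M : structure L) := FGSubstructure {
  fg_set :> set M;
  fg_closed : op_closed fg_set;
  fg_finite : finitely_generated fg_set }.

Section InducedStructure.
Variables (L : language) (M : structure L) (A : fg_substructure M).

Fact induced_op_subproof (s : funsym L)
    (x : 'I_(fun_arity s) -> set_type A) :
  fun_interp s (fun i => val (x i)) \in (A : set M).
Proof. by apply/mem_set/fg_closed => i; exact/set_mem/valP. Qed.

Definition induced : structure L := {|
  domain := set_type A;
  fun_interp s x := exist (fun a => a \in fg_set A) _ (induced_op_subproof x);
  rel_interp r x := rel_interp r (fun i => val (x i)) |}.

End InducedStructure.

Coercion induced : fg_substructure >-> structure.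

Definition extends (L : language) (M : structure L) (A B : fg_substructure M)
    (F : aut M) (f : iso A B) : Prop :=
  forall x : set_type A, F (val x) = val (f x).

Definition set_homogeneous (L : language) (M : structure L) : Prop :=
  forall A B : fg_substructure M, isomorphic A B ->
    exists f : aut M, f @` A = B.

Definition uniformly_homogeneous (L : language) (M : structure L) : Prop :=
  exists K : forall A B : fg_substructure M, iso A B -> aut M,
    [/\ forall A : fg_substructure M, K A A (iso_id A) = 1%g,
        forall (A B : fg_substructure M) (f : iso A B), extends (K A B f) f
      & forall (A B C : fg_substructure M) (f : iso A B) (g : iso C A),
          K C B (iso_comp f g) = (K A B f * K C A g)%g].

(* Main.v *)
From HB Require Import structures.
Require Import Defs.
From mathcomp Require Import all_boot.
From mathcomp Require Import boolp classical_sets functions cardinality.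

(* For the nontrivial direction, choose a representative R in each isomorphism
   class of finitely generated substructures and, by set-homogeneity, for every
   A in the class an automorphism F_A of M restricting to an isomorphism
   u_A : R -> A. Then K(f) := F_B E_R(u_B^-1 f u_A) F_A^-1 for f : A -> B. *)

Local Open Scope classical_set_scope.

Section Restriction.
Context {L : language} {M : structure L}.
Implicit Types (A B : fg_substructure M) (F : aut M).

Lemma restriction_mem {A B} {F} (FAB : F @` A = B) (x : A) :
  F (val x) \in (B : set M).
Proof. by apply/mem_set; rewrite -FAB; exists (val x) => //; exact/set_mem/valP. Qed.

Lemma restriction_inv_mem {A B} {F} (FAB : F @` A = B) (y : B) :
  iso_inv F (val y) \in (A : set M).
Proof.
have := set_mem (valP y); rewrite -[X in X _]FAB => -[x Ax <-].
by rewrite iso_funK; exact/mem_set.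
Qed.

Definition restriction_fun A B F (FAB : F @` A = B) (x : A) : B :=
  exist (fun a => a \in fg_set B) _ (restriction_mem FAB x).

Definition restriction_inv A B F (FAB : F @` A = B) (y : B) : A :=
  exist (fun a => a \in fg_set A) _ (restriction_inv_mem FAB y).

Fact restriction_funK A B F (FAB : F @` A = B) :
  cancel (restriction_fun A B F FAB) (restriction_inv A B F FAB).
Proof. by move=> x; apply: val_inj; exact: iso_funK. Qed.

Fact restriction_invK A B F (FAB : F @` A = B) :
  cancel (restriction_inv A B F FAB) (restriction_fun A B F FAB).
Proof. by move=> x; apply: val_inj; exact: iso_invK. Qed.

Fact restriction_op A B F (FAB : F @` A = B) (s : funsym L)
    (x : 'I_(fun_arity s) -> A) :
  restriction_fun A B F FAB (fun_interp s x) =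
  fun_interp s (restriction_fun A B F FAB \o x).
Proof. by apply: val_inj; exact: iso_op. Qed.

Fact restriction_rel A B F (FAB : F @` A = B) (r : relsym L)
    (x : 'I_(rel_arity r) -> A) :
  rel_interp r x <-> rel_interp r (restriction_fun A B F FAB \o x).
Proof. exact: (iso_rel F (fun i => val (x i))). Qed.

Definition restriction A B F (FAB : F @` A = B) : iso A B :=
  {| iso_fun := restriction_fun A B F FAB;
     iso_inv := restriction_inv A B F FAB;
     iso_funK := restriction_funK A B F FAB;
     iso_invK := restriction_invK A B F FAB;
     iso_op := restriction_op A B F FAB;
     iso_rel := restriction_rel A B F FAB |}.

(** Packaging the automorphism and its restriction as a pair lets a single choice yield both F_A and
    u_A. *)
Lemma set_homogeneous_extends A B : set_homogeneous M -> isomorphic A B ->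
  exists p : aut M * iso A B, extends p.1 p.2.
Proof. by move=> Mhom /Mhom[F FAB]; exists (F, restriction A B F FAB). Qed.

End Restriction.

Section Representative.
Context {L : language} {M : structure L}.
Implicit Types A B : fg_substructure M.

Lemma isomorphic_refl A : isomorphic A A.
Proof. by exists; exact: iso_id. Qed.

(* Picking from the whole isomorphism class as a predicate makes the choice
   depend on the class only. *)
Definition representative A : fg_substructure M :=
  projT1 (cid (ex_intro (fun R : fg_substructure M => isomorphic R A) A
                      (isomorphic_refl A))).

Lemma representativeP A : isomorphic (representative A) A.
Proof. by rewrite /representative; case: cid. Qed.

Lemma representative_eq A B : isomorphic A B ->
  representative A = representative B.
Proof.
move=> [f]; rewrite /representative.
have PE : (fun R : fg_substructure M => isomorphic R A) =
          (fun R : fg_substructure M => isomorphic R B).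
  apply/funext => R; apply/propext; split=> -[g]; exists.
    exact: iso_comp f g.
  exact: iso_comp (iso_sym f) g.
(* Generalizing the existence proofs allows the predicates to be identified; proof irrelevance then
   makes the two choices coincide. *)
move: (ex_intro _ A _) (ex_intro _ B _); rewrite PE => e e'.
by rewrite (Prop_irrelevance e e').
Qed.

End Representative.

Section UniformExtension.
Context {L : language} {M : structure L}.
Implicit Types A B C R : fg_substructure M.
Variable E : forall R, {multiplicative aut R -> aut M}.
Hypothesis E_extends : forall R (h : aut R), extends (E R h) h.
Variable frame : forall R A, isomorphic R A -> aut M * iso R A.
Hypothesis frame_extends : forall R A (RA : isomorphic R A),
  extends (frame R A RA).1 (frame R A RA).2.

(** With A and B framed over the same free parameter R, this is an automorphism of R without any
    transport along equalities of representatives. *)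
Definition transfer R A B (RA : isomorphic R A) (RB : isomorphic R B)
    (f : iso A B) : aut R :=
  iso_comp (iso_sym (frame R B RB).2) (iso_comp f (frame R A RA).2).

Definition framed_extension R A B (RA : isomorphic R A) (RB : isomorphic R B)
    (f : iso A B) : aut M :=
  ((frame R B RB).1 * E R (transfer R A B RA RB f) * (frame R A RA).1^-1)%g.

Lemma framed_extension_id R A (RA : isomorphic R A) :
  framed_extension R A A RA RA (iso_id A) = 1%g.
Proof.
rewrite /framed_extension.
have -> : transfer R A A RA RA (iso_id A) = 1%g.
  by apply: iso_eq => x; exact: iso_funK.
suff -> : E R 1%g = 1%g by rewrite mulg1 mulgV.
(* E(1) E(1) = E(1), and cancelling E(1) leaves E(1) = 1. *)
by apply: (@mulgI _ (E R 1%g)); rewrite -gmulfM !mulg1.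
Qed.

Lemma framed_extension_comp R A B C (RA : isomorphic R A) (RB : isomorphic R B)
    (RC : isomorphic R C) (f : iso A B) (g : iso C A) :
  framed_extension R C B RC RB (iso_comp f g) =
  (framed_extension R A B RA RB f * framed_extension R C A RC RA g)%g.
Proof.
rewrite /framed_extension.
have -> : transfer R C B RC RB (iso_comp f g) =
    (transfer R A B RA RB f * transfer R C A RC RA g)%g.
  (* The inner u_A u_A^-1 cancels; below, F_A^-1 F_A does. *)
  by apply: iso_eq => x /=; rewrite iso_invK.
by rewrite gmulfM !mulgA mulgVK.
Qed.

Lemma framed_extension_extends R A B (RA : isomorphic R A)
    (RB : isomorphic R B) (f : iso A B) :
  extends (framed_extension R A B RA RB f) f.
Proof.
(* Put x = u_A(y): F_A^-1 sends x to y, E_R acts on y as u_B^-1 f u_A, and F_B then acts as u_B,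
   leaving f(x). *)
move=> x; rewrite -[x in LHS](iso_invK (frame R A RA).2 (x : A)).
rewrite -frame_extends /framed_extension /= iso_funK.
by rewrite E_extends frame_extends /= iso_invK iso_invK.
Qed.

(** Frames are indexed by proofs of isomorphism; once the bases are identified, only these proofs
    differ. *)
Lemma framed_extension_irrelevance R R' A B (RA : isomorphic R A)
    (RB : isomorphic R B) (R'A : isomorphic R' A) (R'B : isomorphic R' B)
    (f : iso A B) :
  R = R' -> framed_extension R A B RA RB f = framed_extension R' A B R'A R'B f.
Proof.
by move=> RR'; subst R'; rewrite (Prop_irrelevance R'A RA) (Prop_irrelevance R'B RB).
Qed.

Lemma representative_isomorphic A B (f : iso A B) :
  isomorphic (representative A) B.
Proof. by case: (representativeP A) => g; exists; exact: iso_comp f g. Qed.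

Lemma framed_uniformly_homogeneous : uniformly_homogeneous M.
Proof.
(* B is framed over the representative of A, so both frames share a base by construction. *)
exists (fun A B f => framed_extension (representative A) A B
  (representativeP A) (representative_isomorphic A B f) f); split.
- move=> A; rewrite -(framed_extension_id _ A (representativeP A)).
  exact: framed_extension_irrelevance.
- by move=> A B f; exact: framed_extension_extends.
- move=> A B C f g.
  (* K(g) and K(fg) are built over the representative of C, K(f) over that of A. These agree because
     of g, so everything moves to the latter. *)
  have RC : isomorphic (representative A) C.
    by rewrite -(representative_eq C A (inhabits g)); exact: representativeP.
  rewrite (framed_extension_irrelevance (representative C) (representative A) C A
    _ _ RC (representativeP A)); last exact: representative_eq (inhabits g).
  rewrite -framed_extension_comp.
  by apply: framed_extension_irrelevance; exact: representative_eq (inhabits g).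
Qed.

End UniformExtension.

Theorem proposition1p1 (L : language) (M : structure L) :
  countable_language L -> countable [set: M] -> set_homogeneous M ->
  (uniformly_homogeneous M <->
   forall A : fg_substructure M,
     exists E : {multiplicative aut A -> aut M},
       forall h : aut A, extends (E h) h).
Proof.
move=> _ _ Mhom; split=> [[K [_ K_extends K_comp]] A|ME].
  (* The product of [aut A] unfolds to [iso_comp], so functoriality of [K] on A is
     multiplicativity. *)
  pose Km := isMultiplicative.Build (aut A) (aut M) (K A A) (K_comp A A A).
  pose E : {multiplicative aut A -> aut M} := HB.pack (K A A) Km.
  by exists E => h; exact: K_extends.
pose E A := projT1 (cid (ME A)).
pose frame R A RA := projT1 (cid (set_homogeneous_extends R A Mhom RA)).
apply: (framed_uniformly_homogeneous E _ frame) => [R h|R A RA].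
  exact: (projT2 (cid (ME R))).
exact: (projT2 (cid (set_homogeneous_extends R A Mhom RA))).
Qed.
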